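(* Let $W=\{w_{ij}\}$ and $A=\{a_{ij}\}$ be weighted adjacency matrices, with the same zero/nonzero structure, of a weight-balanced strongly connected digraph on $n$ nodes, with $w_{ij}\ge0$, $a_{ij}\ge0$ and $\sum_{j=1}^n w_{ij}<1$, $\sum_{j=1}^n a_{ij}<1$ for all $i$. Let $H=\mathrm{blockdiag}[\nabla^2 f_i(\mathbf x_i)]\in\mathbb R^{nm\times nm}$ be the block-diagonal Hessian matrix of the local costs $f_i$ described in the context at the state $\mathbf x=[\mathbf x_1;\dots;\mathbf x_n]$ at a given time instant, and let $$M=M(\alpha)=\begin{pmatrix}\overline W\otimes I_m & -\alpha I_{mn}\\ H(\overline W\otimes I_m)&\overline A\otimes I_m-\alpha H\end{pmatrix}.$$ Then for all sufficiently small $\alpha>0$, all eigenvalues of $M$ have non-positive real parts, and the algebraic multiplicity of the zero eigenvalue of $M$ is $m$.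
   Context: Weight-balanced digraph: a strongly connected directed graph with positive link weights ($w_{ij}>0$ for a link from $j$ to $i$, $w_{ij}=0$ otherwise) such that $\sum_{j=1}^n w_{ji}=\sum_{j=1}^n w_{ij}$ for every node $i$. The Laplacian $\overline W$ of $W$ has entries $\overline w_{ij}=w_{ij}$ for $i\ne j$ and $\overline w_{ii}=-\sum_{j=1}^n w_{ij}$; $\overline A$ is defined from $A$ in the same way. $I_k$ is the $k\times k$ identity and $\otimes$ the Kronecker product. Local costs: for $\mathbf x_i=[\boldsymbol\omega_i;\nu_i]\in\mathbb R^{m-1}\times\mathbb R$, $$f_i(\mathbf x_i)=\boldsymbol\omega_i^\top\boldsymbol\omega_i+C\sum_{j=1}^{N_i}\tfrac1\mu\log\bigl(1+\exp(\mu z^i_j)\bigr),\qquad z^i_j=1-l^i_j\bigl(\boldsymbol\omega_i^\top\phi(\boldsymbol\chi^i_j)+\nu_i\bigr),$$ where $C>0$ and $\mu>0$ are constants, $\boldsymbol\chi^i_1,\dots,\boldsymbol\chi^i_{N_i}$ ($N_i\ge1$) are agent $i$'s data points with labels $l^i_j\in\{-1,1\}$, and $\phi$ is a fixed map with values in $\mathbb R^{m-1}$. Each $f_i$ is twice differentiable and strictly convex, with positive definite Hessian $\nabla^2 f_i(\mathbf x_i)$. *)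

(* Defs.v *)
From mathcomp Require Import all_boot all_order all_algebra.
From mathcomp Require Import all_classical all_reals all_analysis.
From mathcomp Require Import complex mxtens.
Set Implicit Arguments.
Unset Strict Implicit.
Unset Printing Implicit Defensive.
Import Order.TTheory GRing.Theory Num.Theory.
Import numFieldNormedType.Exports.
Local Open Scope ring_scope.

(* [E j i] is a link from j to i. Digraphs have no self-loops: with a self-loop
   of positive weight the rows of [laplacian] below would not sum to zero. *)
Definition strongly_connected_digraph n (E : rel 'I_n) : Prop :=
  irreflexive E /\ forall i j, connect E i j.

Definition weighted_adjacency (R : realType) n (E : rel 'I_n) (W : 'M[R]_n) :
    Prop :=
  forall i j, 0 <= W i j /\ (0 < W i j) = E j i.

Definition weight_balanced (R : realType) n (W : 'M[R]_n) : Prop :=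
  forall i, \sum_j W j i = \sum_j W i j.

Definition laplacian (R : realType) n (W : 'M[R]_n) : 'M[R]_n :=
  \matrix_(i, j) (if i == j then - \sum_k W i k else W i j).

Definition local_cost (R : realType) (p : nat) (X : Type)
    (phi : X -> 'cV[R]_p) (C mu : R) (N : nat) (chi : 'I_N -> X)
    (l : 'I_N -> R) (x : 'cV[R]_(p + 1)) : R :=
  let omega := usubmx x in
  let nu := dsubmx x 0 0 in
  let z j := 1 - l j * ((omega^T *m phi (chi j)) 0 0 + nu) in
  (omega^T *m omega) 0 0
    + C * \sum_(j < N) 1 / mu * ln (1 + expR (mu * z j)).

Definition hessian (R : realType) m (f : 'cV[R]_m -> R) (x : 'cV[R]_m) :
    'M[R]_m :=
  \matrix_(j, k)
    'D_(delta_mx j 0 : 'cV[R]_m) (fun y => 'D_(delta_mx k 0 : 'cV[R]_m) f y) x.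

(* The summand is the n x n block matrix with [B i] as its (i, i) block and
   zero blocks elsewhere. *)
Definition blockdiag (R : realType) n m (B : 'I_n -> 'M[R]_m) :
    'M[R]_(n * m) :=
  \sum_i delta_mx i i *t B i.

Definition system_matrix (R : realType) n m (W A : 'M[R]_n)
    (H : 'M[R]_(n * m)) (alpha : R) : 'M[R]_(n * m + n * m) :=
  let LW := laplacian W *t (1%:M : 'M[R]_m) in
  let LA := laplacian A *t (1%:M : 'M[R]_m) in
  block_mx LW        (- (alpha *: 1%:M))
           (H *m LW) (LA - alpha *: H).

Definition complexify (R : realType) k (M : 'M[R]_k) : 'M[R[i]]_k :=
  map_mx (real_complex R) M.

(* Main.v *)
Require Import Defs.
From mathcomp Require Import all_boot all_order all_algebra.
From mathcomp Require Import all_classical all_reals all_analysis.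
From mathcomp Require Import complex mxtens ring lra.
Set Implicit Arguments.
Unset Strict Implicit.
Unset Printing Implicit Defensive.
Import Order.TTheory GRing.Theory Num.Theory.
Import numFieldNormedType.Exports.
Local Open Scope ring_scope.

(* Write L1, L2 for the Kronecker-extended Laplacians of W and A, and J for the
   m x nm matrix whose rows span the consensus space; weight balance gives
   J L = 0 and L J^T = 0. A left eigenvector (x, y) of M for lambda satisfies
   y (L2 - lambda) (L1 - lambda) = - alpha lambda y H.
   Split y = a J + w with w J^T = 0. If Re lambda >= 0 and lambda <> 0, the
   consensus component of this equation and the positivity of the sum of the
   local Hessians bound |a| by a multiple of |w|. On the complement of the
   consensus space -L1 and -L2 are coercive (a Poincare inequality on the
   strongly connected graph), so the other component yields
   c |lambda| |w| <= alpha |lambda| K |w| with c and K independent of alpha and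
   lambda; for small alpha this forces w = 0, hence a = 0.
   For lambda = 0 the same decomposition shows that the left kernel of M is
   spanned by the rows of (- J H, J) and that ker M^2 = ker M, so the algebraic
   multiplicity of 0 is the dimension m of the kernel. *)

(** * Algebraic multiplicity of the eigenvalue zero *)

Lemma char_poly_mulmxC (F : comNzRingType) m n (B : 'M[F]_(m, n)) (D : 'M[F]_(n, m)) :
  'X ^+ n * char_poly (B *m D) = 'X ^+ m * char_poly (D *m B).
Proof.
(* Triangularise [[X, B], [D, 1]] by column and by row operations. *)
rewrite /char_poly /char_poly_mx !map_mxM /=.
set b := map_mx _ B; set d := map_mx _ D.
have up : block_mx 'X%:M b d 1%:M *m block_mx 1%:M 0 (- d) 1%:M
    = block_mx ('X%:M - b *m d) b 0 1%:M.
  by rewrite mulmx_block !mulmx1 !mul1mx !mulmx0 mulmxN !add0r subrr.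
have lo : block_mx 1%:M 0 (- d) 'X%:M *m block_mx 'X%:M b d 1%:M
    = block_mx 'X%:M b 0 ('X%:M - d *m b).
  rewrite mulmx_block !mulmx1 !mul1mx !mul0mx mulNmx !addr0 mul_scalar_mx mul_mx_scalar.
  by rewrite mulNmx addNr [- _ + _]addrC.
move/(congr1 determinant): up; rewrite det_mulmx det_lblock det_ublock !det1 !mulr1 => up.
move/(congr1 determinant): lo.
by rewrite det_mulmx det_lblock det_ublock det1 mul1r !det_scalar up.
Qed.

(** With r = rank M, the full-rank factorisation [M = col_base M *m row_base M] makes [char_poly M]
    equal to X^(n-r) times the characteristic polynomial of the r x r product in the other order.
    The kernel hypothesis makes that product invertible, so 0 is not one of its roots. *)
Lemma mup0_char_poly (F : fieldType) n (M : 'M[F]_n) :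
    (kermx (M *m M) <= kermx M)%MS ->
  mup 0 (char_poly M) = \rank (kermx M).
Proof.
move=> semisimple; have ranks : \rank (row_base M *m col_base M) = \rank M.
  apply/eqP; rewrite -[_ == _]/(row_free _) -kermx_eq0; apply/rowV0P => u.
  (* [col_base M] has full column rank, so a null vector u of the small product lifts to some v, and
     then v M^2 = 0. *)
  move/sub_kermxP => u0; have [v uv] : exists v, u = v *m col_base M.
    have /row_fullP [B B1] : row_full (col_base M) by exact: col_base_full.
    by exists (u *m B); rewrite -mulmxA B1 mulmx1.
  have vM : v *m M = u *m row_base M by rewrite uv -mulmxA mulmx_base.
  have vM2 : (v <= kermx (M *m M))%MS.
    apply/sub_kermxP.
    by rewrite mulmxA vM -[X in _ *m X]mulmx_base mulmxA -(mulmxA u) u0 mul0mx.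
  have /sub_kermxP/eqP := submx_trans vM2 semisimple.
  by rewrite vM mulmx_free_eq0 ?row_base_free// => /eqP.
have nzr : ~~ root (char_poly (row_base M *m col_base M)) 0.
  rewrite rootE horner_coef0 char_poly_det mulf_eq0 signr_eq0 /= -unitfE -unitmxE.
  by rewrite -row_free_unit /row_free ranks.
have := char_poly_mulmxC (col_base M) (row_base M); rewrite mulmx_base.
move/(congr1 (mup 0)); rewrite (mupMl _ nzr) mupM ?expf_neq0 ?polyX_eq0 ?monic_neq0 ?char_poly_monic//.
have mupX k : mup 0 ('X ^+ k : {poly F}) = k.
  by rewrite -['X]subr0 -polyC0 mup_XsubCX eqxx.
rewrite !mupX mxrank_ker => /(congr1 (subn^~ (\rank M))).
by rewrite addKn.
Qed.

(** * Frobenius inner product *)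

(** Several rows are handled at once because a complex row vector will enter as two real rows, its
    real and imaginary parts. *)
Definition fdot (R : pzRingType) m n (U V : 'M[R]_(m, n)) : R := \tr (U *m V^T).

Lemma fdotE (R : pzRingType) m n (U V : 'M[R]_(m, n)) :
  fdot U V = \sum_i \sum_j U i j * V i j.
Proof. by apply: eq_bigr => i _; rewrite mxE; apply: eq_bigr => j _; rewrite mxE. Qed.

Lemma fdotC (R : comPzRingType) m n (U V : 'M[R]_(m, n)) : fdot U V = fdot V U.
Proof. by rewrite /fdot -mxtrace_tr trmx_mul trmxK. Qed.

Lemma fdotDl (R : pzRingType) m n (U V T : 'M[R]_(m, n)) :
  fdot (U + V) T = fdot U T + fdot V T.
Proof. by rewrite /fdot mulmxDl mxtraceD. Qed.

Lemma fdotNl (R : pzRingType) m n (U T : 'M[R]_(m, n)) : fdot (- U) T = - fdot U T.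
Proof. by rewrite /fdot mulNmx linearN. Qed.

Lemma fdotZl (R : pzRingType) m n c (U T : 'M[R]_(m, n)) :
  fdot (c *: U) T = c * fdot U T.
Proof. by rewrite /fdot -scalemxAl mxtraceZ. Qed.

Lemma fdotDr (R : comPzRingType) m n (U V T : 'M[R]_(m, n)) :
  fdot T (U + V) = fdot T U + fdot T V.
Proof. by rewrite fdotC fdotDl !(fdotC T). Qed.

Lemma fdotNr (R : comPzRingType) m n (U T : 'M[R]_(m, n)) : fdot T (- U) = - fdot T U.
Proof. by rewrite fdotC fdotNl fdotC. Qed.

Lemma fdotZr (R : comPzRingType) m n c (U T : 'M[R]_(m, n)) :
  fdot T (c *: U) = c * fdot T U.
Proof. by rewrite fdotC fdotZl fdotC. Qed.

Lemma fdot_ge0 (R : realDomainType) m n (U : 'M[R]_(m, n)) : 0 <= fdot U U.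
Proof. by rewrite fdotE; do 2!apply: sumr_ge0 => ? _; rewrite -expr2 sqr_ge0. Qed.

Lemma fdot_eq0 (R : realDomainType) m n (U : 'M[R]_(m, n)) :
  (fdot U U == 0) = (U == 0).
Proof.
apply/idP/eqP => [|->]; last by rewrite /fdot mul0mx mxtrace0.
rewrite fdotE psumr_eq0 => [/allP U0|? _]; last first.
  by apply: sumr_ge0 => ? _; rewrite -expr2 sqr_ge0.
apply/matrixP => i j; rewrite mxE; have := U0 i (mem_index_enum i).
rewrite psumr_eq0 => [/allP/(_ j (mem_index_enum j))|? _]; last by rewrite -expr2 sqr_ge0.
by rewrite /= mulf_eq0 orbb => /eqP.
Qed.

Lemma fdot_le0 (R : realDomainType) m n (U : 'M[R]_(m, n)) : fdot U U <= 0 -> U = 0.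
Proof. by move=> U0; apply/eqP; rewrite -fdot_eq0 eq_le U0 fdot_ge0. Qed.

(** Expand |c V - U|^2 >= 0 and divide by 2c. *)
Lemma fdot_young (R : realFieldType) m n (U V : 'M[R]_(m, n)) (c : R) : 0 < c ->
  fdot U V <= c / 2 * fdot V V + (2 * c)^-1 * fdot U U.
Proof.
move=> c0; have := fdot_ge0 (c *: V - U).
rewrite fdotDl !fdotDr !fdotNl !fdotNr !fdotZl !fdotZr (fdotC V U) => h.
rewrite -subr_ge0; suff -> : c / 2 * fdot V V + (2 * c)^-1 * fdot U U - fdot U V =
  (2 * c)^-1 * (c * (c * fdot V V) - c * fdot U V + (- (c * fdot U V) + - - fdot U U)).
  by apply: mulr_ge0; [rewrite invr_ge0; lra|move: h; lra].
by field; rewrite gt_eqF.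
Qed.

Lemma fdotD_le (R : realFieldType) m n (U V : 'M[R]_(m, n)) :
  fdot (U + V) (U + V) <= 2 * fdot U U + 2 * fdot V V.
Proof.
have := fdot_ge0 (U - V).
rewrite !fdotDl !fdotDr !fdotNl !fdotNr (fdotC V U); lra.
Qed.

(** A squared operator-norm bound, uniform in the number of rows of U, obtained by adding the
    entries of B one at a time. *)
Lemma fdot_mulmx_le (R : realFieldType) m n (B : 'M[R]_(m, n)) :
  exists2 K : R, 0 < K &
    forall d (U : 'M[R]_(d, m)), fdot (U *m B) (U *m B) <= K * fdot U U.
Proof.
rewrite [B]matrix_sum_delta; elim/big_ind: _ => [|B1 B2 [K1 K10 h1] [K2 K20 h2]|i _].
- by exists 1 => // d U; rewrite mulmx0 /fdot mul0mx mxtrace0 mul1r fdot_ge0.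
- exists (2 * K1 + 2 * K2) => [|d U]; first lra.
  rewrite mulmxDr (le_trans (fdotD_le _ _))//.
  have := h1 d U; have := h2 d U; lra.
elim/big_ind: _ => [|B1 B2 [K1 K10 h1] [K2 K20 h2]|j _].
- by exists 1 => // d U; rewrite mulmx0 /fdot mul0mx mxtrace0 mul1r fdot_ge0.
- exists (2 * K1 + 2 * K2) => [|d U]; first lra.
  rewrite mulmxDr (le_trans (fdotD_le _ _))//.
  have := h1 d U; have := h2 d U; lra.
(* The summand 1 keeps the constant positive when the entry vanishes. *)
exists (B i j ^+ 2 + 1) => [|d U]; first by rewrite ltr_wpDl ?sqr_ge0.
rewrite -scalemxAr fdotZl fdotZr mulrA -expr2 mulrDl mul1r.
rewrite ler_wpDr ?fdot_ge0// ler_wpM2l ?sqr_ge0//.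
rewrite {1}/fdot trmx_mul trmx_delta -mulmxA (mulmxA (delta_mx i j)) mul_delta_mx.
rewrite mulmxA -/(fdot _ _) !fdotE; apply: ler_sum => r _.
rewrite (bigD1 i)//= [X in _ <= X](bigD1 i)//= [X in _ + X]big1 => [|k ki]; last first.
  rewrite mxE big1 ?mul0r// => l _; rewrite mxE (negbTE ki) andbF mulr0 //.
rewrite addr0 ler_wpDr//; first by apply: sumr_ge0 => ? _; rewrite -expr2 sqr_ge0.
rewrite mxE (bigD1 i)//= mxE !eqxx mulr1 big1 ?addr0// => l /negbTE li.
by rewrite mxE li mulr0.
Qed.

(** * Coercivity and the abstract spectral argument *)

(** Positivity is asked only on rows orthogonal to those of J; taking J = 0 gives positivity on the
    whole space. *)
Definition coercive_on_kernel (R : realFieldType) m k (J : 'M[R]_(m, k))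
    (B : 'M[R]_k) : Prop :=
  exists2 c : R, 0 < c & forall d (U : 'M[R]_(d, k)),
    U *m J^T = 0 -> c * fdot U U <= fdot (U *m B) U.

(* The action of a complex number z with |z|^2 = q and Re z >= 0 on the real and
   imaginary parts of a vector, stacked as the rows of [U]. *)
Definition rotation_scaling (R : realFieldType) d (L : 'M[R]_d) (q : R) : Prop :=
  forall k (U : 'M[R]_(d, k)),
    0 <= fdot (L *m U) U /\ fdot (L *m U) (L *m U) = q * fdot U U.

(* The constant does not depend on the spectral parameter [L]. *)
Lemma resolvent_le (R : realFieldType) m k (J : 'M[R]_(m, k)) (B : 'M[R]_k) :
  coercive_on_kernel J (- B) ->
  exists2 K : R, 0 < K & forall d (L : 'M[R]_d) q (U : 'M[R]_(d, k)),
    rotation_scaling L q -> U *m J^T = 0 ->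
    fdot U U <= K * fdot (U *m B - L *m U) (U *m B - L *m U) /\
    q * fdot U U <= K * fdot (U *m B - L *m U) (U *m B - L *m U).
Proof.
case=> c c0 hc; have [K K0 hK] := fdot_mulmx_le B.
have c2 : 0 < (c ^+ 2)^-1 by rewrite invr_gt0 exprn_gt0.
exists (2 + (1 + 2 * K) * (c ^+ 2)^-1) => [|d L q U hL UJ].
  by rewrite addr_gt0// mulr_gt0//; lra.
set T := U *m B - L *m U.
(* Coercivity and Re z >= 0 together give c |U|^2 <= -<T, U>; Young's inequality absorbs half of the
   left side. *)
have hT : fdot U U <= (c ^+ 2)^-1 * fdot T T.
  have h1 := hc _ _ UJ; have [h2 _] := hL _ U.
  have h3 := fdot_young (- T) U c0.
  have TU : fdot T U = fdot (U *m B) U - fdot (L *m U) U by rewrite fdotDl fdotNl.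
  rewrite mulmxN fdotNl in h1; rewrite !fdotNl fdotNr opprK TU in h3.
  have h4 : c / 2 * fdot U U <= (2 * c)^-1 * fdot T T by lra.
  rewrite -[fdot U U]mul1r -(ler_pM2l c0).
  have -> : c * (1 * fdot U U) = 2 * (c / 2 * fdot U U) by field.
  have -> : c * ((c ^+ 2)^-1 * fdot T T) = 2 * ((2 * c)^-1 * fdot T T).
    by field; rewrite gt_eqF.
  by rewrite ler_pM2l.
have T0 := fdot_ge0 T; have U0 := fdot_ge0 U.
have P0 : 0 <= (c ^+ 2)^-1 * fdot T T by rewrite mulr_ge0 // ltW.
rewrite !mulrDl; split.
  have : 0 <= 2 * K * (c ^+ 2)^-1 * fdot T T.
    by rewrite -mulrA; apply: mulr_ge0 => //; lra.
  lra.
(* q |U|^2 is |L U|^2, and L U = U B - T. *)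
have [_ <-] := hL _ U.
have -> : L *m U = - T + U *m B by rewrite opprB subrK.
rewrite (le_trans (fdotD_le _ _))// fdotNl fdotNr opprK.
have := hK _ U; have : K * fdot U U <= K * ((c ^+ 2)^-1 * fdot T T).
  by rewrite ler_pM2l.
move=> h1 h2; lra.
Qed.

(** L encodes an eigenvalue z with |z|^2 = q, and (X, Y) is a left eigenvector. [alpha0] is fixed
    before L and q, so one threshold serves every nonzero z with Re z >= 0. *)
Lemma no_right_eigenvalue (R : realFieldType) m k (J : 'M[R]_(m, k))
    (L1 L2 H : 'M[R]_k) (nu : R) :
  0 < nu -> J *m J^T = nu%:M ->
  J *m L1 = 0 -> L1 *m J^T = 0 -> J *m L2 = 0 -> L2 *m J^T = 0 ->
  coercive_on_kernel J (- L1) -> coercive_on_kernel J (- L2) ->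
  coercive_on_kernel (0 : 'M[R]_m) (J *m H *m J^T) ->
  exists2 alpha0 : R, 0 < alpha0 & forall alpha, 0 < alpha -> alpha < alpha0 ->
    forall d (L : 'M[R]_d) q (X Y : 'M[R]_(d, k)),
      rotation_scaling L q -> 0 < q ->
      X *m L1 + Y *m (H *m L1) = L *m X ->
      - (alpha *: X) + Y *m (L2 - alpha *: H) = L *m Y ->
      X = 0 /\ Y = 0.
Proof.
move=> nu0 JJ JL1 LJ1 JL2 LJ2 /resolvent_le[c1 c10 h1] /resolvent_le[c2 c20 h2].
case=> c c0 hc.
(* [nu^-1 *: (J^T *m J)] is the orthogonal projection onto the consensus rows, so acting by G on row
   vectors is acting by H and then projecting onto the complement. *)
pose G := H - nu^-1 *: (H *m (J^T *m J)).
have [K1 K10 hK1] := fdot_mulmx_le (H *m J^T).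
have [K2 K20 hK2] := fdot_mulmx_le G.
pose K3 := K2 * (2 * nu * (K1 / c ^+ 2) + 2).
have K30 : 0 < K3.
  apply: mulr_gt0 => //; apply: ltr_wpDl => //; apply: mulr_ge0; first lra.
  by rewrite divr_ge0// ?exprn_ge0// ltW.
pose K4 := c2 * (c1 * K3).
have K40 : 0 < K4 by apply: mulr_gt0 => //; apply: mulr_gt0.
(* From alpha <= 1 and alpha K4 < 1 it follows that alpha^2 K4 < 1, which closes the final
   contraction. *)
exists (Num.min 1 K4^-1); first by rewrite lt_min ltr01 invr_gt0.
move=> alpha a0; rewrite lt_min => /andP[a1 aK] d L q X Y hL q0 e1 e2.
have cancelL k' (V : 'M[R]_(d, k')) : L *m V = 0 -> V = 0.
  move=> LV; apply: fdot_le0; have [_] := hL _ V.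
  rewrite LV {1}/fdot mul0mx mxtrace0 => /esym/eqP.
  by rewrite mulf_eq0 gt_eqF//= => /eqP ->.
pose a := nu^-1 *: (Y *m J^T); pose w := Y - a *m J.
have Ydec : Y = w + a *m J by rewrite subrK.
have wJ : w *m J^T = 0.
  rewrite mulmxBl -mulmxA JJ mul_mx_scalar scalerA divff ?scale1r ?subrr//.
  by rewrite gt_eqF.
(* The second equation says Z = alpha (X + Y H); the first then eliminates X. *)
pose Z := Y *m L2 - L *m Y.
have Zeq : Z *m L1 - L *m Z = - (alpha *: (L *m (Y *m H))).
  have -> : Z = alpha *: (X + Y *m H).
    apply/eqP; rewrite /Z -e2 mulmxBr -scalemxAr scalerDr subr_eq.
    by rewrite addrACA subrr add0r addrC subrK.
  rewrite -scalemxAl -scalemxAr mulmxDl -(mulmxA Y) e1 mulmxDr scalerDr.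
  by rewrite opprD addrA subrr add0r.
(* Consensus component: right multiplication by J^T kills L1 and L2, and injectivity of L removes
   one factor L. *)
have aeq : L *m a = - (alpha / nu) *: (Y *m (H *m J^T)).
  have /(congr1 (mulmx^~ J^T)) := Zeq.
  rewrite mulmxBl -mulmxA LJ1 mulmx0 sub0r -mulmxA mulmxBl -(mulmxA Y) LJ2 mulmx0 sub0r.
  rewrite mulmxN opprK mulNmx -scalemxAl -!mulmxA => /eqP; rewrite -subr_eq0 opprK.
  rewrite scalemxAr -mulmxDr => /eqP/cancelL/eqP; rewrite addr_eq0 => /eqP.
  by rewrite /a -scalemxAr => ->; rewrite scalerN scalerA mulrC scaleNr.
have aw : fdot a a <= K1 / c ^+ 2 * fdot w w.
  (* Re z >= 0 turns the formula for L a into <Y H J^T, a> <= 0. After inserting Y = w + a J,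
     coercivity of J H J^T and Young's inequality bound a by w. *)
  have [ge0 _] := hL _ a; move: ge0.
  rewrite aeq fdotZl mulNr oppr_ge0 pmulr_rle0 ?divr_gt0//.
  rewrite {1}Ydec mulmxDl fdotDl -mulmxA !(mulmxA J) => h3.
  have h4 := hc _ a; move: h4; rewrite trmx0 mulmx0 => /(_ erefl) h4.
  have := fdot_young (- (w *m (H *m J^T))) a c0; rewrite !fdotNl fdotNr opprK => h5.
  have h6 := hK1 _ w.
  have h7 : (2 * c)^-1 * fdot (w *m (H *m J^T)) (w *m (H *m J^T)) <= (2 * c)^-1 * (K1 * fdot w w).
    by rewrite ler_pM2l// invr_gt0; lra.
  have h8 : c / 2 * fdot a a <= (2 * c)^-1 * (K1 * fdot w w) by lra.
  have -> : fdot a a = (2 / c) * (c / 2 * fdot a a) by field; rewrite gt_eqF.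
  have -> : K1 / c ^+ 2 * fdot w w = (2 / c) * ((2 * c)^-1 * (K1 * fdot w w)).
    by field; rewrite gt_eqF.
  by rewrite ler_pM2l// divr_gt0.
pose w1 := w *m L2 - L *m w.
have w1J : w1 *m J^T = 0 by rewrite mulmxBl -!mulmxA LJ2 wJ !mulmx0 subrr.
have Zw : Z = w1 - L *m (a *m J).
  by rewrite /Z {1 2}Ydec mulmxDl -(mulmxA a) JL2 mulmx0 addr0 mulmxDr opprD addrA.
(* Removing the consensus part of Z and substituting the formula for L a replaces H by G. *)
have w1eq : w1 *m L1 - L *m w1 = - (alpha *: (L *m (Y *m G))).
  have -> : w1 *m L1 - L *m w1 = (Z *m L1 - L *m Z) - L *m (L *m a *m J).
    rewrite Zw (mulmxBl w1) -(mulmxA L (a *m J)) -(mulmxA a) JL1 !mulmx0 subr0 (mulmxBr L w1).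
    by rewrite opprB addrA !mulmxA addrAC addrK.
  rewrite Zeq aeq /G mulmxBr mulmxBr -!scalemxAr -!scalemxAl -!scalemxAr scalerBr.
  by rewrite scalerA !mulmxA scaleNr opprK opprB addrC.
have Yw : fdot Y Y <= (2 * nu * (K1 / c ^+ 2) + 2) * fdot w w.
  rewrite Ydec (le_trans (fdotD_le _ _))//.
  have -> : fdot (a *m J) (a *m J) = nu * fdot a a.
    by rewrite /fdot trmx_mul -mulmxA (mulmxA J) JJ mul_scalar_mx -scalemxAr mxtraceZ.
  have : nu * fdot a a <= nu * (K1 / c ^+ 2 * fdot w w) by rewrite ler_pM2l.
  lra.
have GK : fdot (Y *m G) (Y *m G) <= K3 * fdot w w.
  by rewrite (le_trans (hK2 _ _))// /K3 -mulrA ler_pM2l.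
(* The bound through L2 is taken with the factor q, the one through L1 without it. The right side of
   [w1eq] carries one factor L, hence the same q, which cancels. *)
have [_ {}h2] := h2 _ _ _ _ hL wJ; have [{}h1 _] := h1 _ _ _ _ hL w1J.
move: h1; rewrite w1eq fdotNl fdotNr opprK fdotZl fdotZr.
have [_ ->] := hL _ (Y *m G) => h1.
have w0 : fdot w w = 0.
  have ww0 := fdot_ge0 w.
  have h3 : q * fdot w w <= q * (alpha ^+ 2 * K4 * fdot w w).
    apply: (le_trans h2); rewrite -/w1.
    have -> : q * (alpha ^+ 2 * K4 * fdot w w) = c2 * (c1 * (alpha * (alpha * (q * (K3 * fdot w w))))).
      by rewrite /K4; ring.
    rewrite ler_pM2l// (le_trans h1)// !ler_pM2l//.
  move: h3; rewrite ler_pM2l// => h3.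
  have a2K : alpha ^+ 2 * K4 < 1.
    apply: (@le_lt_trans _ _ (alpha * K4)); last by rewrite -ltr_pdivlMr// div1r.
    by rewrite ler_pM2r// expr2 ler_piMr// ltW.
  apply/eqP; rewrite eq_le ww0 andbT.
  have : (1 - alpha ^+ 2 * K4) * fdot w w <= 0 by rewrite mulrBl mul1r subr_le0.
  by rewrite pmulr_rle0// subr_gt0.
have Y0 : Y = 0 by apply: fdot_le0; rewrite (le_trans Yw)// w0 mulr0.
split=> //; move: e2; rewrite Y0 mul0mx mulmx0 addr0 => /eqP.
by rewrite oppr_eq0 scaler_eq0 gt_eqF//= => /eqP.
Qed.

(** Subtract from Y its projection on the rows of J: the remainder is still annihilated by B, so
    coercivity makes it zero. *)
Lemma left_kernel_consensus (R : realFieldType) m k (J : 'M[R]_(m, k)) (B : 'M[R]_k)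
    (nu : R) d (Y : 'M[R]_(d, k)) :
  0 < nu -> J *m J^T = nu%:M -> J *m B = 0 -> coercive_on_kernel J (- B) ->
  Y *m B = 0 -> exists b, Y = b *m J.
Proof.
move=> nu0 JJ JB [c c0 hc] YB; exists (nu^-1 *: (Y *m J^T)).
apply/eqP; rewrite -subr_eq0; set b := _ *: _; apply/eqP/fdot_le0.
have wJ : (Y - b *m J) *m J^T = 0.
  rewrite mulmxBl -mulmxA JJ mul_mx_scalar scalerA divff ?scale1r ?subrr//.
  by rewrite gt_eqF.
have := hc _ _ wJ; rewrite mulmxN mulmxBl YB -mulmxA JB mulmx0 subr0 oppr0.
by rewrite {2}/fdot mul0mx mxtrace0 pmulr_rle0.
Qed.

(** The rank is the geometric multiplicity of 0; the inclusion excludes nontrivial Jordan blocks, so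
    it is also the algebraic one. *)
Lemma block_kernel (R : realFieldType) m k (J : 'M[R]_(m, k))
    (L1 L2 H : 'M[R]_k) (nu alpha : R) (M := block_mx L1 (- (alpha *: 1%:M))
           (H *m L1) (L2 - alpha *: H)) :
  0 < nu -> 0 < alpha -> J *m J^T = nu%:M ->
  J *m L1 = 0 -> L1 *m J^T = 0 -> J *m L2 = 0 -> L2 *m J^T = 0 ->
  coercive_on_kernel J (- L1) -> coercive_on_kernel J (- L2) ->
  coercive_on_kernel (0 : 'M[R]_m) (J *m H *m J^T) ->
  \rank (kermx M) = m /\ (kermx (M *m M) <= kermx M)%MS.
Proof.
move=> nu0 a0 JJ JL1 LJ1 JL2 LJ2 h1 h2 [c c0 hc].
have mulM d (X Y : 'M[R]_(d, k)) : row_mx X Y *m M =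
    row_mx ((X + Y *m H) *m L1) (Y *m L2 - alpha *: (X + Y *m H)).
  rewrite mul_row_block mulmxA -mulmxDl mulmxN -scalemxAr mulmx1 mulmxBr -scalemxAr.
  by rewrite scalerDr opprD addrCA.
have M0 d (X Y : 'M[R]_(d, k)) : row_mx X Y *m M = 0 ->
    X = - (Y *m H) /\ exists b, Y = b *m J.
  rewrite mulM -[0]row_mx0 => /eq_row_mx[e1 /eqP].
  rewrite subr_eq0 => /eqP e2'; move: (e2') => e2.
  have {}e2 : Y *m L2 = 0.
    (* The first component makes alpha (X + Y H) a consensus vector. It also equals Y L2, which is
       orthogonal to consensus by L2 J^T = 0, so both vanish. *)
    have [b eb] : exists b, alpha *: (X + Y *m H) = b *m J.
      apply: left_kernel_consensus nu0 JJ JL1 h1 _.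
      by rewrite -scalemxAl e1 scaler0.
    have /eqP : nu *: b = 0.
      by rewrite -mul_mx_scalar -JJ mulmxA -eb -e2 -mulmxA LJ2 mulmx0.
    by rewrite e2 eb scaler_eq0 gt_eqF//= => /eqP ->; rewrite mul0mx.
  split.
    have /eqP : alpha *: (X + Y *m H) = 0 by rewrite -e2' e2.
    by rewrite scaler_eq0 gt_eqF//= addr_eq0 => /eqP.
  exact: left_kernel_consensus nu0 JJ JL2 h2 e2.
split.
  pose K0 := row_mx (- (J *m H)) J.
  have K0free : row_free K0.
    apply/row_freeP; exists (col_mx 0 (nu^-1 *: J^T)).
    by rewrite mul_row_col mulmx0 add0r -scalemxAr JJ scale_scalar_mx mulVf ?gt_eqF.
  suff /eqmx_rank -> : (kermx M == K0)%MS by apply/eqP.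
  apply/andP; split; last first.
    by apply/sub_kermxP; rewrite mulM addNr mul0mx JL2 scaler0 subrr row_mx0.
  have := mulmx_ker M; rewrite -[kermx M]hsubmxK => /M0[-> [b ->]].
  by rewrite -mulmxA -mulmxN -mul_mx_row submxMl.
apply/sub_kermxP; have := mulmx_ker (M *m M).
rewrite mulmxA -[kermx _]hsubmxK; set X := lsubmx _; set Y := rsubmx _.
set S := X + Y *m H.
rewrite mulM => /M0[e1 [b e2]].
(* Multiplying [e1] by J^T gives b J H J^T = 0, and coercivity forces b = 0. *)
have b0 : b = 0.
  apply: fdot_le0; have := hc _ b; rewrite trmx0 mulmx0 => /(_ erefl).
  have -> : b *m (J *m H *m J^T) = 0.
    have /(congr1 (mulmx^~ J^T)) := e1.
    rewrite -mulmxA LJ1 mulmx0 e2 mulNmx => /esym/eqP; rewrite oppr_eq0 => /eqP.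
    by rewrite !mulmxA.
  by rewrite {2}/fdot mul0mx mxtrace0 pmulr_rle0.
by rewrite e1 e2 b0 !mul0mx oppr0 row_mx0.
Qed.

(** * Consensus space and Kronecker products *)

Lemma sum_mxtens_index (V : nmodType) n m (F : 'I_(n * m) -> V) :
  \sum_e F e = \sum_i \sum_k F (mxtens_index (i, k)).
Proof.
rewrite pair_big (reindex (@mxtens_index n m)) /=; last first.
  by exists (@mxtens_unindex n m) => ? _; rewrite ?mxtens_indexK ?mxtens_unindexK.
by apply: eq_bigr => -[i k].
Qed.

(** The Kronecker product of the all-ones row with the identity, written entrywise so that it has
    [m] rows rather than [1 * m]. *)
Definition consensus (R : pzRingType) n m : 'M[R]_(m, n * m) :=
  \matrix_(k, e) (k == (mxtens_unindex e).2)%:R.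

Lemma consensusE (R : pzRingType) n m k (i : 'I_n) (l : 'I_m) :
  consensus R n m k (mxtens_index (i, l)) = (k == l)%:R.
Proof. by rewrite mxE mxtens_indexK. Qed.

Lemma mulmx_consensus_tr (R : pzRingType) n m d (U : 'M[R]_(d, n * m)) r k :
  (U *m (consensus R n m)^T) r k = \sum_i U r (mxtens_index (i, k)).
Proof.
rewrite mxE sum_mxtens_index; apply: eq_bigr => i _.
rewrite (bigD1 k)//= mxE consensusE eqxx mulr1 big1 ?addr0// => l lk.
by rewrite mxE consensusE eq_sym (negbTE lk) mulr0.
Qed.

Lemma consensus_mulmx (R : pzRingType) n m d (U : 'M[R]_(n * m, d)) r k :
  (consensus R n m *m U) k r = \sum_i U (mxtens_index (i, k)) r.
Proof.
rewrite mxE sum_mxtens_index; apply: eq_bigr => i _.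
rewrite (bigD1 k)//= consensusE eqxx mul1r big1 ?addr0// => l lk.
by rewrite consensusE eq_sym (negbTE lk) mul0r.
Qed.

Lemma consensus_mul_tr (R : pzRingType) n m :
  consensus R n m *m (consensus R n m)^T = n%:R%:M.
Proof.
apply/matrixP => k l; rewrite mulmx_consensus_tr (eq_bigr (fun=> (k == l)%:R)).
  by rewrite sumr_const card_ord mxE -!mulrnA mulnC.
by move=> i _; rewrite consensusE.
Qed.

Lemma consensus_blockdiag (R : realType) n m (B : 'I_n -> 'M[R]_m) :
  consensus R n m *m blockdiag B *m (consensus R n m)^T = \sum_i B i.
Proof.
rewrite mulmx_sumr mulmx_suml; apply: eq_bigr => i _; apply/matrixP => k l.
rewrite mulmx_consensus_tr (bigD1 i)//= consensus_mulmx (bigD1 i)//= tensmxE mxE !eqxx mul1r.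
rewrite big1 ?addr0 => [|j ji]; last by rewrite tensmxE mxE (negbTE ji) mul0r.
rewrite big1 ?addr0// => j ji; rewrite consensus_mulmx big1// => j' _.
by rewrite tensmxE mxE (negbTE ji) andbF mul0r.
Qed.

Lemma consensus_tens (R : comPzRingType) n m (B : 'M[R]_n) :
  (forall j, \sum_i B i j = 0) -> consensus R n m *m (B *t 1%:M) = 0.
Proof.
move=> B0; apply/matrixP => k e; case: (mxtens_indexP e) => j l.
rewrite consensus_mulmx mxE (eq_bigr (fun i => B i j * (1%:M : 'M[R]_m) k l)).
  by rewrite -mulr_suml B0 mul0r.
by move=> i _; rewrite tensmxE.
Qed.

Lemma tens_consensus (R : comPzRingType) n m (B : 'M[R]_n) :
  (forall i, \sum_j B i j = 0) -> (B *t 1%:M) *m (consensus R n m)^T = 0.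
Proof.
move=> B0; apply/matrixP => e k; case: (mxtens_indexP e) => j l.
rewrite mulmx_consensus_tr mxE (eq_bigr (fun i => B j i * (1%:M : 'M[R]_m) l k)).
  by rewrite -mulr_suml B0 mul0r.
by move=> i _; rewrite tensmxE.
Qed.

Lemma fdot_tens1 (R : comPzRingType) n m d (B : 'M[R]_n) (U : 'M[R]_(d, n * m)) :
  fdot (U *m (B *t 1%:M)) U = \sum_r \sum_k \sum_j \sum_i
    U r (mxtens_index (i, k)) * B i j * U r (mxtens_index (j, k)).
Proof.
rewrite fdotE; apply: eq_bigr => r _; rewrite sum_mxtens_index exchange_big /=.
apply: eq_bigr => k _; apply: eq_bigr => j _.
rewrite mxE sum_mxtens_index mulr_suml; apply: eq_bigr => i _.
rewrite (bigD1 k)//= tensmxE mxE eqxx mulr1 big1 ?addr0// => l lk.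
by rewrite tensmxE mxE (negbTE lk) !mulr0.
Qed.

(** * Laplacian form and Poincare inequality on the digraph *)

Definition dirichlet (R : realType) n (W : 'M[R]_n) (u : 'I_n -> R) : R :=
  \sum_i \sum_j W i j * (u i - u j) ^+ 2.

Section Laplacian.
Variables (R : realType) (n : nat) (E : rel 'I_n) (W : 'M[R]_n).
Hypotheses (E_sc : strongly_connected_digraph E) (W_adj : weighted_adjacency E W).
Hypothesis W_bal : weight_balanced W.

Let W_diag i : W i i = 0.
Proof.
have [ge0 E0] := W_adj i i; move: E0; rewrite (E_sc.1 i) => /negbT.
by rewrite -leNgt => le0; apply/eqP; rewrite eq_le le0.
Qed.

(** Absence of self-loops makes the diagonal of [W] zero, so one formula covers both cases. *)
Lemma laplacianE i j : laplacian W i j = W i j - (i == j)%:R * \sum_k W i k.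
Proof.
rewrite mxE; case: eqVneq => [->|_]; last by rewrite mul0r subr0.
by rewrite W_diag mul1r sub0r.
Qed.

Lemma laplacian_row_sum i : \sum_j laplacian W i j = 0.
Proof.
under eq_bigr do rewrite laplacianE.
rewrite big_split /= sumrN (bigD1 i _ (F := fun j => _ * _))//= eqxx mul1r.
rewrite [X in _ - (_ + X)]big1 ?addr0 ?subrr// => j ji.
by rewrite eq_sym (negbTE ji) mul0r.
Qed.

Lemma laplacian_col_sum j : \sum_i laplacian W i j = 0.
Proof.
under eq_bigr do rewrite laplacianE.
rewrite big_split /= sumrN (bigD1 j _ (F := fun j => _ * _))//= eqxx mul1r.
rewrite [X in _ - (_ + X)]big1 ?addr0 ?W_bal ?subrr// => i ij.
by rewrite (negbTE ij) mul0r.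
Qed.

(** Expanding the squares leaves row sums and column sums on the diagonal; weight balance identifies
    them, and the energy is twice the form. *)
Lemma laplacian_form (u : 'I_n -> R) :
  \sum_j \sum_i u i * (- laplacian W) i j * u j = dirichlet W u / 2.
Proof.
have -> : \sum_j \sum_i u i * (- laplacian W) i j * u j =
    \sum_i (\sum_k W i k) * u i ^+ 2 - \sum_i \sum_j W i j * (u i * u j).
  rewrite exchange_big -sumrB; apply: eq_bigr => i _ /=.
  rewrite [X in X - _](_ : _ = \sum_j (i == j)%:R * (\sum_k W i k) * (u i * u j)).
    rewrite -sumrB; apply: eq_bigr => j _.
    by rewrite mxE laplacianE; ring.
  rewrite [RHS](bigD1 i)//= eqxx mul1r expr2 [X in _ = _ + X]big1 ?addr0// => j ji.
  by rewrite eq_sym (negbTE ji) !mul0r.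
have -> : dirichlet W u = \sum_i (\sum_k W i k) * u i ^+ 2
    + \sum_j (\sum_k W k j) * u j ^+ 2 - 2 * \sum_i \sum_j W i j * (u i * u j).
  have -> : \sum_j (\sum_k W k j) * u j ^+ 2 = \sum_k \sum_j W k j * u j ^+ 2.
    by rewrite exchange_big; apply: eq_bigr => j _; rewrite mulr_suml.
  rewrite mulr_sumr -big_split -sumrB; apply: eq_bigr => i _ /=.
  rewrite mulr_suml mulr_sumr -big_split -sumrB; apply: eq_bigr => j _ /=; ring.
under [X in _ + X - _]eq_bigr do rewrite W_bal.
lra.
Qed.

Lemma dirichlet_ge0 u : 0 <= dirichlet W u.
Proof.
apply: sumr_ge0 => i _; apply: sumr_ge0 => j _; rewrite mulr_ge0 ?sqr_ge0//.
by have [] := W_adj i j.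
Qed.

(** Induction along a directed path: a link costs the inverse of its weight, and joining it to the
    rest uses (a + b)^2 <= 2 a^2 + 2 b^2. *)
Lemma dirichlet_path i j : exists2 c, 0 <= c &
  forall u, (u i - u j) ^+ 2 <= c * dirichlet W u.
Proof.
have /connectP[p] := E_sc.2 i j; elim: p i => [|k p IH] i /=.
  by move=> _ ->; exists 0 => // u; rewrite subrr expr0n/= mul0r.
move=> /andP[Eik pk] /(IH _ pk)[c c0 hc].
have Wki : 0 < W k i by have [_ ->] := W_adj k i.
exists (2 * c + 2 * (W k i)^-1) => [|u].
  by have := invr_gt0 (W k i); rewrite Wki => ?; lra.
have step : (u i - u k) ^+ 2 <= (W k i)^-1 * dirichlet W u.
  rewrite ler_pdivlMl// /dirichlet (bigD1 k)//= (bigD1 i)//=.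
  rewrite (_ : (u k - u i) ^+ 2 = (u i - u k) ^+ 2); last by ring.
  rewrite -addrA ler_wpDr// addr_ge0//; last apply: sumr_ge0 => a _; apply: sumr_ge0 => b _.
    by rewrite mulr_ge0 ?sqr_ge0//; have [] := W_adj k b.
  by rewrite mulr_ge0 ?sqr_ge0//; have [] := W_adj a b.
rewrite mulrDl -!mulrA.
apply: (@le_trans _ _ (2 * (u k - u j) ^+ 2 + 2 * (u i - u k) ^+ 2)).
  rewrite -subr_ge0; apply: le_trans (sqr_ge0 ((u i - u k) - (u k - u j))) _.
  by rewrite le_eqVlt; apply/orP; left; apply/eqP; ring.
by apply: lerD; rewrite ler_pM2l.
Qed.

(** For zero-sum u the squared differences over all n^2 ordered pairs add up to 2n times the sum of
    squares, and each is at most c times the energy; hence the constant 2 / (n c). *)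
Lemma dirichlet_poincare : (0 < n)%N -> exists2 c, 0 < c & forall u,
  \sum_i u i = 0 -> c * \sum_i u i ^+ 2 <= dirichlet W u.
Proof.
move=> n0.
have [c c0 hc] : exists2 c, 0 < c & forall u i j, (u i - u j) ^+ 2 <= c * dirichlet W u.
  (* One constant per ordered pair, by finite choice; 1 plus their sum is positive and serves all
     pairs. *)
  have [c hc] := fin_all_exists (fun ij : 'I_n * 'I_n =>
    let: ex_intro2 c c0 hc := dirichlet_path ij.1 ij.2 in
    ex_intro (fun c => 0 <= c /\ forall u, (u ij.1 - u ij.2) ^+ 2 <= c * dirichlet W u) c (conj c0 hc)).
  exists (1 + \sum_ij c ij) => [|u i j].
    by rewrite ltr_wpDr//; apply: sumr_ge0 => ij _; exact: (hc ij).1.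
  rewrite (le_trans ((hc (i, j)).2 u))// ler_wpM2r ?dirichlet_ge0//.
  rewrite (bigD1 (i, j))//= addrCA ler_wpDr// addr_ge0//.
  by apply: sumr_ge0 => ij _; exact: (hc ij).1.
have n0' : 0 < n%:R :> R by rewrite ltr0n.
exists (2 / (n%:R * c)) => [|u u0].
  by rewrite divr_gt0// mulr_gt0.
rewrite mulrAC ler_pdivrMr ?mulr_gt0// -(ler_pM2l n0').
have -> : n%:R * (2 * \sum_i u i ^+ 2) = \sum_i \sum_j (u i - u j) ^+ 2.
  have -> : \sum_i \sum_j (u i - u j) ^+ 2 =
      \sum_i (n%:R * u i ^+ 2 + \sum_j u j ^+ 2 - 2 * u i * \sum_j u j).
    apply: eq_bigr => i _; rewrite mulr_sumr.
    have -> : n%:R * u i ^+ 2 = \sum_(j < n) u i ^+ 2.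
      by rewrite sumr_const card_ord mulr_natl.
    by rewrite -big_split -sumrB; apply: eq_bigr => j _ /=; ring.
  rewrite u0 big_split/= big_split/= -mulr_sumr sumr_const card_ord -mulr_natl.
  rewrite [X in _ + X]big1 => [|i _]; first by ring.
  by rewrite mulr0 oppr0.
have -> : n%:R * (dirichlet W u * (n%:R * c)) = \sum_(i < n) \sum_(j < n) c * dirichlet W u.
  by rewrite !sumr_const !card_ord -(mulr_natl (_ *+ _)) -(mulr_natl (c * _)); ring.
by do 2!apply: ler_sum => ? _; exact: hc.
Qed.

(** For each row r and coordinate k, U J^T = 0 says that the entries of U sum to zero over the
    nodes, so the Poincare inequality applies to each (r, k) separately. *)
Lemma laplacian_coercive m : (0 < n)%N ->
  coercive_on_kernel (consensus R n m) (- (laplacian W *t 1%:M)).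
Proof.
move=> /dirichlet_poincare[c c0 hc]; exists (c / 2) => [|d U UJ]; first by rewrite divr_gt0.
have -> : - (laplacian W *t (1%:M : 'M[R]_m)) = (- laplacian W) *t 1%:M.
  by apply/matrixP => i j; rewrite !mxE mulNr.
rewrite fdot_tens1 fdotE mulr_sumr; apply: ler_sum => r _.
rewrite sum_mxtens_index exchange_big mulr_sumr; apply: ler_sum => k _ /=.
rewrite laplacian_form mulrAC ler_pM2r ?invr_gt0//.
under eq_bigr do rewrite -expr2.
by apply: (hc (fun i => _)); rewrite -mulmx_consensus_tr UJ mxE.
Qed.
End Laplacian.

(** * Derivatives of the local costs *)

Lemma is_derive_line (R : realType) (V W : normedModType R) (f : V -> W) (x v : V) df :
  is_derive (0 : R) 1 (fun h : R => f (h *: v + x)) df -> is_derive x v f df.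
Proof.
move=> [fx <-]; split; first exact/(derivable1P f x v).
rewrite /derive.
set g1 := fun h => h^-1 *: _; set g2 := fun h => h^-1 *: _.
suff -> : g1 = g2 by [].
by rewrite funeqE /g1 /g2 => h /=; rewrite addr0 scale0r add0r [_%:A]mulr1.
Qed.

Lemma is_derive_comp_dot (R : realType) m (b x v : 'cV[R]_m) (g : R -> R) (dg : R) :
  is_derive ((x^T *m b) 0 0) 1 g dg ->
  is_derive x v (fun y : 'cV[R]_m => g ((y^T *m b) 0 0)) ((v^T *m b) 0 0 * dg).
Proof.
move=> hg; apply: is_derive_line.
set s := (x^T *m b) 0 0; set a := (v^T *m b) 0 0.
rewrite (_ : (fun h => _) = g \o (fun h : R => h * a + s)); last first.
  apply/funext => h /=; congr g.
  by rewrite linearD linearZ /= mulmxDl -scalemxAl mxE [X in X + _]mxE.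
rewrite mulrC.
have haff : is_derive (0 : R) 1 (fun h : R => h * a + s) a.
  have := @is_deriveD _ _ _ _ _ (0 : R) 1 _ _ (@is_deriveM _ _ id (cst a) (0 : R) 1 _ _ _ _) (@is_derive_cst _ _ _ s (0 : R) 1).
  move=> /(_ _ _ _ _)/is_derive_eq; apply.
  by rewrite /= scaler0 add0r addr0 /GRing.scale /= mulr1.
apply: is_derive1_comp.
by rewrite mul0r add0r.
Qed.

Lemma is_derive_quad (R : realType) m (D : 'M[R]_m) (x v : 'cV[R]_m) : D^T = D ->
  is_derive x v (fun y : 'cV[R]_m => (y^T *m D *m y) 0 0) (2 * (x^T *m (D *m v)) 0 0).
Proof.
move=> Dsym; apply: is_derive_line.
set s := (x^T *m D *m x) 0 0; set a := (x^T *m (D *m v)) 0 0; pose q := (v^T *m D *m v) 0 0.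
have a' : (v^T *m D *m x) 0 0 = a.
  by rewrite /a -[in LHS](trmxK (_ *m x)) mxE trmx_mul trmx_mul trmxK Dsym.
rewrite (_ : (fun h => _) = horner (q%:P * 'X^2 + (2 * a)%:P * 'X + s%:P)); last first.
  apply/funext => h /=.
  have addE (A B : 'M[R]_1) : (A + B) 0 0 = A 0 0 + B 0 0 by rewrite mxE.
  have scaleE c (A : 'M[R]_1) : (c *: A) 0 0 = c * A 0 0 by rewrite mxE.
  rewrite [(_ + _)^T]linearD /= [(_ *: _)^T]linearZ /= !mulmxDl !mulmxDr -!scalemxAl -!scalemxAr.
  rewrite !addE !scaleE a' -/q -/s -[x^T *m D *m v]mulmxA -/a.
  by rewrite !hornerE /=; ring.
have := is_derive_poly (q%:P * 'X^2 + (2 * a)%:P * 'X + s%:P) (0 : R).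
move/is_derive_eq; apply.
by rewrite !(derivD, derivM, derivC, derivXn, derivX) !hornerE /=; ring.
Qed.

(** The logistic function appears as 1 - 1 / (1 + e^t), ready to be differentiated once more by the
    rule for inverses. *)
Lemma is_derive_softplus (R : realType) (t : R) :
  is_derive t 1 (fun t => ln (1 + expR t)) (1 - (1 + expR t)^-1).
Proof.
have p : 0 < 1 + expR t by rewrite addr_gt0// expR_gt0.
have h1 : is_derive t 1 (fun t => 1 + expR t) (expR t).
  have := is_deriveD (is_derive_cst (1 : R) t 1) (is_derive_expR t).
  by rewrite add0r.
have := @is_derive1_comp R (@ln R) (fun t => 1 + expR t) t _ _ (is_derive1_ln p) h1.
move/is_derive_eq; apply.
by field; rewrite gt_eqF.
Qed.

Lemma is_derive_sigmoid (R : realType) (t : R) :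
  is_derive t 1 (fun t => 1 - (1 + expR t)^-1) (expR t / (1 + expR t) ^+ 2).
Proof.
have p : 0 < 1 + expR t by rewrite addr_gt0// expR_gt0.
have h1 : is_derive t 1 (fun t => 1 + expR t) (expR t).
  have := is_deriveD (is_derive_cst (1 : R) t 1) (is_derive_expR t).
  by rewrite add0r.
have h2 := @is_deriveV R (fun t => 1 + expR t) t _ _ (lt0r_neq0 p) h1.
have := is_deriveB (is_derive_cst (1 : R) t 1) h2.
move/is_derive_eq; apply.
by rewrite sub0r scaleNr opprK /GRing.scale /= mulrC.
Qed.

(** The matrix of the form omega^T omega on the stacked variable; it vanishes in the bias
    direction. *)
Definition reg_mx (R : pzRingType) p : 'M[R]_(p + 1) := block_mx 1%:M 0 0 0.
(** The appended 1 absorbs the bias nu into a single inner product. *)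
Definition feature (R : pzRingType) p (u : 'cV[R]_p) : 'cV[R]_(p + 1) := col_mx u 1%:M.

Lemma reg_mx_sym (R : pzRingType) p : (reg_mx R p)^T = reg_mx R p.
Proof. by rewrite /reg_mx tr_block_mx trmx1 !trmx0. Qed.

Lemma dot_feature (R : realType) p (u : 'cV[R]_p) (x : 'cV[R]_(p + 1)) :
  ((usubmx x)^T *m u) 0 0 + dsubmx x 0 0 = (x^T *m feature u) 0 0.
Proof.
rewrite -[in RHS](vsubmxK x) tr_col_mx mul_row_col mulmx1.
by rewrite [in RHS]mxE [X in _ = _ + X]mxE.
Qed.

Lemma local_costE (R : realType) p (X : Type) (phi : X -> 'cV[R]_p) (C mu : R) N
    (chi : 'I_N -> X) (l : 'I_N -> R) :
  local_cost phi C mu chi l = (fun x => (x^T *m reg_mx R p *m x) 0 0)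
    + C / mu \*: \sum_(j < N) (fun x : 'cV[R]_(p + 1) =>
        ln (1 + expR (mu * (1 - l j * (x^T *m feature (phi (chi j))) 0 0)))).
Proof.
apply/funext => x; rewrite /local_cost [RHS]/=.
rewrite [RHS](_ : _ = (x^T *m reg_mx R p *m x) 0 0 + C / mu * \sum_(j < N)
        ln (1 + expR (mu * (1 - l j * (x^T *m feature (phi (chi j))) 0 0)))); last first.
  by rewrite fct_sumE.
congr (_ + _).
  rewrite -[in RHS](vsubmxK x) tr_col_mx /reg_mx mul_row_block !mulmx0 !addr0 mulmx1.
  by rewrite mul_row_col mul0mx addr0.
rewrite -[RHS]mulrA; congr (_ * _); rewrite mulr_sumr; apply: eq_bigr => j _.
by rewrite dot_feature mul1r.
Qed.

(** The second derivative in s of [1 / mu * ln (1 + expR (mu * (1 - l * s)))] at s = x^T b. *)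
Definition logistic_weight (R : realType) p (mu l : R) (b x : 'cV[R]_(p + 1)) : R :=
  let t := mu * (1 - l * (x^T *m b) 0 0) in
  mu * l ^+ 2 * (expR t / (1 + expR t) ^+ 2).

Lemma is_derive_affine_comp (R : realType) (g : R -> R) (c l s dg : R) :
  is_derive (c * (1 - l * s)) 1 g dg ->
  is_derive s 1 (fun s => g (c * (1 - l * s))) (- (c * l) * dg).
Proof.
move=> hg; rewrite mulrC.
have haff : is_derive s 1 (fun s : R => c * (1 - l * s)) (- (c * l)).
  rewrite (_ : (fun s => _) = horner (- (c * l)%:P * 'X + c%:P)); last first.
    by apply/funext => h; rewrite !hornerE /=; ring.
  have := is_derive_poly (- (c * l)%:P * 'X + c%:P) s.
  move/is_derive_eq; apply.
  by rewrite -polyCN !(derivD, derivM, derivC, derivX) !hornerE /=; ring.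
exact: (@is_derive1_comp R g (fun s => c * (1 - l * s)) s _ _ hg haff).
Qed.

Lemma derive_local_cost (R : realType) p (X : Type) (phi : X -> 'cV[R]_p) (C mu : R) N
    (chi : 'I_N -> X) (l : 'I_N -> R) (x v : 'cV[R]_(p + 1)) : mu != 0 ->
  'D_v (local_cost phi C mu chi l) x = 2 * (x^T *m (reg_mx R p *m v)) 0 0
    + C * \sum_(j < N) - l j * (v^T *m feature (phi (chi j))) 0 0 *
       (1 - (1 + expR (mu * (1 - l j * (x^T *m feature (phi (chi j))) 0 0)))^-1).
Proof.
move=> mu0; rewrite local_costE.
have hq := is_derive_quad x v (reg_mx_sym R p).
have hs j : is_derive x v (fun x : 'cV[R]_(p + 1) =>
    ln (1 + expR (mu * (1 - l j * (x^T *m feature (phi (chi j))) 0 0)))) _ :=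
  is_derive_comp_dot v (is_derive_affine_comp (is_derive_softplus
    (mu * (1 - l j * (x^T *m feature (phi (chi j))) 0 0)))).
have := is_deriveD hq (is_deriveZ (C / mu) (is_derive_sum hs)) => /@derive_val ->.
congr (_ + _); rewrite /GRing.scale /= !mulr_sumr; apply: eq_bigr => j _.
by move: (1 - (1 + expR _)^-1) => sg; field.
Qed.

(** Each data point enters through one scalar product, so it contributes a rank-one matrix weighted
    by a second derivative. *)
Lemma hessian_local_cost (R : realType) p (X : Type) (phi : X -> 'cV[R]_p) (C mu : R) N
    (chi : 'I_N -> X) (l : 'I_N -> R) (x : 'cV[R]_(p + 1)) : mu != 0 ->
  hessian (local_cost phi C mu chi l) x = 2 *: reg_mx R p + \sum_(j < N)
    C * logistic_weight mu (l j) (feature (phi (chi j))) x *: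
      (feature (phi (chi j)) *m (feature (phi (chi j)))^T).
Proof.
move=> mu0; apply/matrixP => j k; rewrite mxE.
set v := delta_mx k 0; set u := delta_mx j 0.
have entry (b : 'cV[R]_(p + 1)) a : ((delta_mx a 0)^T *m b) 0 0 = b a 0.
  rewrite mxE (bigD1 a)//= !mxE !eqxx mul1r big1 ?addr0// => i /negbTE ia.
  by rewrite !mxE ia mul0r.
rewrite (_ : (fun y => _) = (fun y : 'cV[R]_(p + 1) => 2 * (y^T *m (reg_mx R p *m v)) 0 0)
    + C \*: \sum_(j < N) (fun y : 'cV[R]_(p + 1) =>  - l j * (v^T *m feature (phi (chi j))) 0 0 *
       (1 - (1 + expR (mu * (1 - l j * (y^T *m feature (phi (chi j))) 0 0)))^-1))); last first.
  apply/funext => y; rewrite derive_local_cost// [RHS]/=.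
  by congr (_ + _); rewrite fct_sumE.
have hq : is_derive x u (fun y : 'cV[R]_(p + 1) => 2 * (y^T *m (reg_mx R p *m v)) 0 0) _ :=
  is_derive_comp_dot u (is_deriveZ 2 (is_derive_id _ (1 : R))).
have hs i : is_derive x u (fun y : 'cV[R]_(p + 1) => - l i * (v^T *m feature (phi (chi i))) 0 0 *
       (1 - (1 + expR (mu * (1 - l i * (y^T *m feature (phi (chi i))) 0 0)))^-1)) _ :=
  is_derive_comp_dot u (is_deriveZ (- l i * (v^T *m feature (phi (chi i))) 0 0)
   (is_derive_affine_comp (is_derive_sigmoid
    (mu * (1 - l i * (x^T *m feature (phi (chi i))) 0 0))))).
have := is_deriveD hq (is_deriveZ C (is_derive_sum hs)) => /@derive_val ->.
have outer (b : 'cV[R]_(p + 1)) : (b *m b^T) j k = b j 0 * b k 0.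
  by rewrite mxE big_ord1 mxE.
rewrite entry -colE [col _ _ _ _]mxE [RHS]mxE [X in _ = X + _]mxE summxE.
congr (_ + _); first by rewrite /GRing.scale /= mulr1 mulrC.
rewrite /GRing.scale /= mulr_sumr; apply: eq_bigr => i _.
by rewrite !entry [RHS]mxE outer /logistic_weight; ring.
Qed.

(** * Positive definiteness of the local Hessians *)

Lemma fdot_row_mx (R : pzRingType) d m n (A B : 'M[R]_(d, m)) (A' B' : 'M[R]_(d, n)) :
  fdot (row_mx A A') (row_mx B B') = fdot A B + fdot A' B'.
Proof. by rewrite /fdot tr_row_mx mul_row_col mxtraceD. Qed.

Lemma fdot_col_mx (R : pzRingType) d e m (A B : 'M[R]_(d, m)) (A' B' : 'M[R]_(e, m)) :
  fdot (col_mx A A') (col_mx B B') = fdot A B + fdot A' B'.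
Proof. by rewrite /fdot tr_col_mx mul_col_row mxtrace_block. Qed.

Lemma logistic_weight_gt0 (R : realType) p (mu l : R) (b x : 'cV[R]_(p + 1)) :
  0 < mu -> l != 0 -> 0 < logistic_weight mu l b x.
Proof.
move=> mu0 l0; rewrite /logistic_weight; apply: mulr_gt0.
  by rewrite mulr_gt0// lt_neqAle eq_sym sqrf_eq0 l0 sqr_ge0.
by rewrite divr_gt0 ?expR_gt0// exprn_gt0// addr_gt0// expR_gt0.
Qed.

(** The regulariser controls only the omega part A of U. The bias part equals U b - A phi for a data
    point with feature vector b, so the loss at that point controls it together with A. *)
Lemma hessian_coercive (R : realType) p (X : Type) (phi : X -> 'cV[R]_p) (C mu : R) N
    (chi : 'I_N -> X) (l : 'I_N -> R) (x : 'cV[R]_(p + 1)) :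
  0 < C -> 0 < mu -> (0 < N)%N -> (forall j, l j != 0) ->
  coercive_on_kernel (0 : 'M[R]_(p + 1)) (hessian (local_cost phi C mu chi l) x).
Proof.
move=> C0 mu0 N0 l0; rewrite hessian_local_cost ?gt_eqF//.
pose b j := feature (phi (chi j)); pose s j := C * logistic_weight mu (l j) (b j) x.
have s0 j : 0 < s j by rewrite mulr_gt0 ?logistic_weight_gt0.
pose j0 := Ordinal N0.
have [K K0 hK] := fdot_mulmx_le (phi (chi j0)).
(* The first entry pays for the omega part, c (1 + 2K) <= 2; the second for the data term, 2c <= s
   j0. *)
pose c := Num.min (2 / (1 + 2 * K)) (s j0 / 2).
have c0 : 0 < c by rewrite lt_min !divr_gt0//; lra.
have c1 : c * (1 + 2 * K) <= 2.
  by rewrite -ler_pdivlMr ?ge_min ?lexx//; lra.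
have c2 : c * 2 <= s j0 by rewrite -ler_pdivlMr ?ge_min ?lexx ?orbT.
exists c => // d U _.
have -> : fdot (U *m (2 *: reg_mx R p + \sum_j s j *: (b j *m (b j)^T))) U =
    2 * fdot (lsubmx U) (lsubmx U) + \sum_j s j * fdot (U *m b j) (U *m b j).
  rewrite mulmxDr fdotDl -scalemxAr fdotZl; congr (_ * _ + _).
    rewrite -{1 2}(hsubmxK U) /reg_mx mul_row_block !mulmx0 !addr0 mulmx1.
    by rewrite fdot_row_mx {2}/fdot mul0mx mxtrace0 addr0.
  rewrite /fdot mulmx_sumr mulmx_suml raddf_sum; apply: eq_bigr => j _ /=.
  by rewrite -scalemxAr -scalemxAl mxtraceZ trmx_mul !mulmxA.
rewrite (bigD1 j0)//=.
have rest : 0 <= \sum_(j < N | j != j0) s j * fdot (U *m b j) (U *m b j).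
  by apply: sumr_ge0 => j _; rewrite mulr_ge0 ?fdot_ge0// ltW.
set T := U *m b j0; set A := lsubmx U.
have -> : fdot U U = fdot A A + fdot (rsubmx U) (rsubmx U).
  by rewrite -{1 2}(hsubmxK U) fdot_row_mx.
have -> : rsubmx U = T - A *m phi (chi j0).
  rewrite /T -[in U *m _](hsubmxK U) /b /feature mul_row_col mulmx1.
  by rewrite addrAC subrr add0r.
have := fdotD_le T (- (A *m phi (chi j0))); rewrite !fdotNl !fdotNr opprK => h1.
have := hK _ A => h2.
have A0 := fdot_ge0 A; have T0 := fdot_ge0 T.
have h3 : c * fdot (T - A *m phi (chi j0)) (T - A *m phi (chi j0)) <=
    c * (2 * fdot T T + 2 * (K * fdot A A)).
  by rewrite ler_pM2l//; lra.
have h4 : c * (1 + 2 * K) * fdot A A <= 2 * fdot A A by rewrite ler_wpM2r.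
have h5 : c * 2 * fdot T T <= s j0 * fdot T T by rewrite ler_wpM2r.
rewrite mulrDr; lra.
Qed.

Lemma coercive_sum (R : realFieldType) n m (B : 'I_n -> 'M[R]_m) : (0 < n)%N ->
  (forall i, coercive_on_kernel (0 : 'M[R]_m) (B i)) ->
  coercive_on_kernel (0 : 'M[R]_m) (\sum_i B i).
Proof.
move=> n0 hB; have [c c0 hc] := hB (Ordinal n0).
exists c => // d U U0; rewrite mulmx_sumr (bigD1 (Ordinal n0))//= fdotDl.
apply: ler_wpDr; last exact: hc.
rewrite /fdot mulmx_suml raddf_sum; apply: sumr_ge0 => i _ /=.
have [e e0 he] := hB i.
by apply: le_trans (he _ U U0); rewrite mulr_ge0 ?fdot_ge0// ltW.
Qed.

(** * From complex eigenvectors to pairs of real rows *)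

(** The block matrix is multiplication by a + ib; its skew part drops out of the inner product,
    leaving a |U|^2. *)
Lemma rotation_scaling_block (R : realFieldType) (a b : R) : 0 <= a ->
  rotation_scaling (block_mx a%:M (- b)%:M b%:M a%:M : 'M[R]_(1 + 1)) (a ^+ 2 + b ^+ 2).
Proof.
move=> a0 k U; rewrite -(vsubmxK U); set P := usubmx U; set Q := dsubmx U.
rewrite mul_block_col !mul_scalar_mx !fdot_col_mx !fdotDl !fdotDr !fdotZl !fdotZr (fdotC Q P).
split; last by ring.
have := fdot_ge0 P; have := fdot_ge0 Q => Q0 P0.
rewrite (_ : _ + _ = a * (fdot P P + fdot Q Q)); last by ring.
by rewrite mulr_ge0 ?addr_ge0.
Qed.

(** Since M is real, taking real and imaginary parts commutes with multiplication by it. *)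
Lemma realify_mulmx (R : rcfType) k (M : 'M[R]_k) (v : 'rV[R[i]]_k) (z : R[i]) :
  v *m map_mx (real_complex R) M = z *: v ->
  let U := col_mx (map_mx (@complex.Re R) v) (map_mx (@complex.Im R) v) in
  U *m M = block_mx (complex.Re z)%:M (- complex.Im z)%:M
                    (complex.Im z)%:M (complex.Re z)%:M *m U.
Proof.
move=> e U; rewrite mul_col_mx mul_block_col !mul_scalar_mx; congr col_mx.
- have /(congr1 (map_mx (@complex.Re R))) := e.
  rewrite [X in _ = X](_ : _ = complex.Re z *: map_mx (@complex.Re R) v
     + - complex.Im z *: map_mx (@complex.Im R) v); last first.
    by clear e; apply/rowP => j; rewrite !mxE; case: z (v 0 j) => [a b] [c d] /=; rewrite mulNr.
  move<-; apply/rowP => j; rewrite !mxE raddf_sum; apply: eq_bigr => i _.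
  by rewrite !mxE; case: (v 0 i) => c d /=; rewrite mulr0 subr0.
- have /(congr1 (map_mx (@complex.Im R))) := e.
  rewrite [X in _ = X](_ : _ = complex.Im z *: map_mx (@complex.Re R) v
     + complex.Re z *: map_mx (@complex.Im R) v); last first.
    by clear e; apply/rowP => j; rewrite !mxE; case: z (v 0 j) => [a b] [c d] /=; rewrite addrC.
  move<-; apply/rowP => j; rewrite !mxE raddf_sum; apply: eq_bigr => i _.
  by rewrite !mxE; case: (v 0 i) => c d /=; rewrite mulr0 add0r.
Qed.

(** * Assembly of the stability and multiplicity claims *)

Theorem theorem1 (R : realType) (n p : nat) (X : Type)
    (phi : X -> 'cV[R]_p) (C mu : R)
    (N : 'I_n -> nat)
    (chi : forall i : 'I_n, 'I_(N i) -> X)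
    (l : forall i : 'I_n, 'I_(N i) -> R)
    (E : rel 'I_n) (W A : 'M[R]_n)
    (x : 'I_n -> 'cV[R]_(p + 1))
    (n_gt0 : (0 < n)%N)
    (C_gt0 : 0 < C) (mu_gt0 : 0 < mu)
    (N_gt0 : forall i : 'I_n, (0 < N i)%N)
    (l_pm1 : forall (i : 'I_n) (j : 'I_(N i)), l i j = -1 \/ l i j = 1)
    (E_sc : strongly_connected_digraph E)
    (W_adj : weighted_adjacency E W) (A_adj : weighted_adjacency E A)
    (W_bal : weight_balanced W) (A_bal : weight_balanced A)
    (W_lt1 : forall i : 'I_n, \sum_j W i j < 1)
    (A_lt1 : forall i : 'I_n, \sum_j A i j < 1) :
  let H := blockdiag (fun i : 'I_n =>
             hessian (local_cost phi C mu (chi i) (l i)) (x i)) in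
  exists2 alpha0 : R, 0 < alpha0 &
    forall alpha : R, 0 < alpha -> alpha < alpha0 ->
      let M := complexify (system_matrix W A H alpha) in
      (forall lambda : R[i], eigenvalue M lambda -> complex.Re lambda <= 0) /\
      mup 0 (char_poly M) = (p + 1)%N.
Proof.
move=> H; pose J := consensus R n (p + 1).
pose LW := laplacian W *t (1%:M : 'M[R]_(p + 1)).
pose LA := laplacian A *t (1%:M : 'M[R]_(p + 1)).
have n0 : 0 < n%:R :> R by rewrite ltr0n.
have JJ := consensus_mul_tr R n (p + 1).
have JLW : J *m LW = 0 by apply: consensus_tens; exact: laplacian_col_sum E_sc W_adj W_bal.
have JLA : J *m LA = 0 by apply: consensus_tens; exact: laplacian_col_sum E_sc A_adj A_bal.
have LWJ : LW *m J^T = 0 by apply: tens_consensus; exact: laplacian_row_sum E_sc W_adj.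
have LAJ : LA *m J^T = 0 by apply: tens_consensus; exact: laplacian_row_sum E_sc A_adj.
have cW := laplacian_coercive E_sc W_adj W_bal (p + 1) n_gt0.
have cA := laplacian_coercive E_sc A_adj A_bal (p + 1) n_gt0.
have cH : coercive_on_kernel (0 : 'M[R]_(p + 1)) (J *m H *m J^T).
  rewrite consensus_blockdiag; apply: coercive_sum => // i; apply: hessian_coercive => // j.
  by case: (l_pm1 i j) => ->; rewrite ?oppr_eq0 oner_eq0.
have [alpha0 alpha0_gt0 stable] :=
  no_right_eigenvalue n0 JJ JLW LWJ JLA LAJ cW cA cH.
exists alpha0 => // alpha a_gt0 a_lt M; split; last first.
  have [rk ss] := block_kernel n0 a_gt0 JJ JLW LWJ JLA LAJ cW cA cH.
  (* The rank and the inclusion of kernels are known over the reals and pass through the embedding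
     into the complex numbers. *)
  rewrite mup0_char_poly.
    by rewrite /M /complexify -map_kermx mxrank_map rk.
  by rewrite /M /complexify -map_mxM -!map_kermx map_submx.
(* [eigenvalue] supplies a row eigenvector v. If Re z > 0, then |z|^2 > 0 and both real rows of v
   must vanish. *)
move=> z /eigenvalueP[v vz v0]; rewrite leNgt; apply/negP => z0.
have /= := realify_mulmx vz; set L := block_mx _ _ _ _; set U := col_mx _ _ => UM.
have rs := rotation_scaling_block (complex.Im z) (ltW z0).
have q0 : 0 < complex.Re z ^+ 2 + complex.Im z ^+ 2.
  by rewrite ltr_wpDr ?sqr_ge0// exprn_gt0.
move: UM; rewrite -(hsubmxK U) mul_mx_row /system_matrix mul_row_block.
case/eq_row_mx; rewrite mulmxN -scalemxAr mulmx1 => e1 e2.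
have [X0 Y0] := stable _ a_gt0 a_lt _ _ _ _ _ rs q0 e1 e2.
have U0 : U = 0 by rewrite -(hsubmxK U) X0 Y0 row_mx0.
move: U0; rewrite /U -[0]col_mx0 => /eq_col_mx[Re0 Im0].
case/eqP: v0; apply/rowP => j.
move/rowP/(_ j): Re0; move/rowP/(_ j): Im0; rewrite !mxE.
by case: (v 0 j) => a b /= -> ->.
Qed.
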